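(* In the model described in the context, the Bayesian belief of agent $i$ at time one, following her observations of the beliefs $\mu_{j,0}(\cdot)$, $j\in\mathcal{N}(i)$, of her neighbors at time zero and of her own private signal $\mathbf{s}_{i,0}$ at time zero, is given by $$\mu_{i,1}(\hat\theta)=\frac{\nu_i(\hat\theta)\,\ell_i(\mathbf{s}_{i,0}\mid\hat\theta)\Big(\prod_{j\in\mathcal{N}(i)}\frac{\mu_{j,0}(\hat\theta)}{\nu_j(\hat\theta)}\Big)}{\sum_{\tilde\theta\in\Theta}\nu_i(\tilde\theta)\,\ell_i(\mathbf{s}_{i,0}\mid\tilde\theta)\Big(\prod_{j\in\mathcal{N}(i)}\frac{\mu_{j,0}(\tilde\theta)}{\nu_j(\tilde\theta)}\Big)},\qquad\forall\,\hat\theta\in\Theta.$$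
   Context: There are $n$ agents labeled by $[n]=\{1,\dots,n\}$ interacting on a directed graph $([n],\mathcal{E})$; $\mathcal{N}(i)=\{j\in[n]:(j,i)\in\mathcal{E}\}$ is the neighborhood of $i$, with $i\notin\mathcal{N}(i)$. $\Theta$ is a finite set of states. Each agent $i$ has a finite signal space $\mathcal{S}_i$, probability mass functions $\ell_i(\cdot\mid\hat\theta)$, $\hat\theta\in\Theta$, on $\mathcal{S}_i$ with $\ell_i(s\mid\hat\theta)>0$ for all $s\in\mathcal{S}_i$, and a prior probability mass function $\nu_i$ on $\Theta$ with $\nu_i(\hat\theta)>0$ for all $\hat\theta$. Priors and signal structures are common knowledge. Conditionally on the state being $\hat\theta$, the time-zero signals $\mathbf{s}_{i,0}$, $i\in[n]$, are independent with $\mathbf{s}_{i,0}\sim\ell_i(\cdot\mid\hat\theta)$. The belief of agent $j$ at time zero is $$\mu_{j,0}(\hat\theta)=\frac{\nu_j(\hat\theta)\,\ell_j(\mathbf{s}_{j,0}\mid\hat\theta)}{\sum_{\tilde\theta\in\Theta}\nu_j(\tilde\theta)\,\ell_j(\mathbf{s}_{j,0}\mid\tilde\theta)},\quad\hat\theta\in\Theta.$$ The Bayesian belief $\mu_{i,1}$ of agent $i$ at time one is the conditional distribution of the state given $\mathbf{s}_{i,0}$ and the (function-valued) observations $\mu_{j,0}(\cdot)$, $j\in\mathcal{N}(i)$, under the joint law in which the state is distributed according to agent $i$'s prior $\nu_i$ and, given that the state is $\hat\theta$, the signals $\mathbf{s}_{k,0}$, $k\in[n]$, are independent with $\mathbf{s}_{k,0}\sim\ell_k(\cdot\mid\hat\theta)$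 (each $\mu_{j,0}$ being the function of $\mathbf{s}_{j,0}$ given by $\mu_{j,0}(\hat\theta)=\nu_j(\hat\theta)\,\ell_j(\mathbf{s}_{j,0}\mid\hat\theta)\big/\sum_{\tilde\theta\in\Theta}\nu_j(\tilde\theta)\,\ell_j(\mathbf{s}_{j,0}\mid\tilde\theta)$, with prior $\nu_j$). *)

(* Defs.v *)
From HB Require Import structures.
From mathcomp Require Import all_boot all_order all_algebra.

Set Implicit Arguments.
Unset Strict Implicit.
Unset Printing Implicit Defensive.

Import Order.TTheory GRing.Theory Num.Theory.

Local Open Scope ring_scope.

Definition is_pmf (R : realFieldType) (T : finType) (p : T -> R) : Prop :=
  (forall x, 0 <= p x) /\ \sum_x p x = 1.

Definition prob (R : realFieldType) (T : finType) (p : T -> R)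
    (A : {set T}) : R :=
  \sum_(x in A) p x.

(* Since 0^-1 = 0, this is the conditional probability of A given B only when
   B has positive probability. *)
Definition cond_prob (R : realFieldType) (T : finType) (p : T -> R)
    (A B : {set T}) : R :=
  prob p (A :&: B) / prob p B.

(* E j i stands for (j, i) being an edge, so agent i observes its
   in-neighbors. *)
Definition nbhd (n : nat) (E : rel 'I_n) (i : 'I_n) : {set 'I_n} :=
  [set j | E j i].

Section Model.

Variables (R : realFieldType) (n : nat) (Theta : finType).
Variables (S : 'I_n -> finType).
Variables (nu : 'I_n -> Theta -> R).
Variables (l : forall k : 'I_n, Theta -> S k -> R).

Definition profile := {dffun forall k : 'I_n, S k}.

(* A finite function, so that the observation of mu_{j,0}(.) is an equality
   of whole functions on Theta, decidable by ==. *)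
Definition belief0 (j : 'I_n) (sj : S j) : {ffun Theta -> R} :=
  [ffun th => nu j th * l th sj / \sum_(th' : Theta) nu j th' * l th' sj].

(* The law, from the viewpoint of agent i, of the pair (state, signals): the
   state has law nu i, and given the state the signals are independent. *)
Definition joint_law (i : 'I_n) (w : Theta * profile) : R :=
  nu i w.1 * \prod_(k < n) l w.1 (w.2 k).

(* The event that agent i's own signal and the functions mu_{j,0}(.), for j in
   its neighborhood, take the values they have at the realized profile s. *)
Definition info_event (E : rel 'I_n) (i : 'I_n) (s : profile) :
    {set Theta * profile} :=
  [set w : Theta * profile | (w.2 i == s i) &&
    [forall j in nbhd E i, belief0 (w.2 j) == belief0 (s j)]].

Definition belief1 (E : rel 'I_n) (i : 'I_n) (s : profile) (th : Theta) : R :=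
  cond_prob (joint_law i) [set w | w.1 == th] (info_event E i s).

End Model.

(* Main.v *)
(* By Bayes' rule a signal x of agent j satisfies
   l_j(x | th) = c_j(x) * mu_{j,0}(th) / nu_j(th), where c_j(x) is the
   denominator of mu_{j,0}. Summing over all x that yield the same belief
   function, the probability given th of observing mu_{j,0} is
   mu_{j,0}(th) / nu_j(th) times a positive constant independent of th, and
   these constants cancel between numerator and denominator of mu_{i,1}. *)
Require Import Defs.
From HB Require Import structures.
From mathcomp Require Import all_boot all_order all_algebra.

Set Implicit Arguments.
Unset Strict Implicit.
Unset Printing Implicit Defensive.

Import Order.TTheory GRing.Theory Num.Theory.

Local Open Scope ring_scope.

(** A constraint imposed coordinate by coordinate can be absorbed into the factors, by setting each
    to zero off [Q k]; what remains is distributivity of product over sum. This is how independence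
    of the signals enters. *)
Lemma sum_dffun_prod (R : comPzSemiRingType) (I : finType) (T : I -> finType)
    (Q : forall k, pred (T k)) (F : forall k, T k -> R) :
  \sum_(w : {dffun forall k, T k} | [forall k, Q k (w k)]) \prod_k F k (w k) =
  \prod_k \sum_(x | Q k x) F k x.
Proof.
pose G k : {ffun T k -> R} := [ffun x => if Q k x then F k x else 0].
transitivity (\sum_(w : {dffun forall k, T k}) \prod_k G k (w k)).
  rewrite big_mkcond; apply: eq_bigr => w _.
  case: ifPn => [/forallP Qw|].
    by apply: eq_bigr => k _; rewrite ffunE Qw.
  rewrite negb_forall => /existsP[k /negPf Qk].
  by rewrite (bigD1 k) //= ffunE Qk mul0r.
rewrite (reindex (@dffun_of_fprod _ T)); last first.
  exact/onW_bij/dffun_of_fprod_bij.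
transitivity (\sum_(w : fprod T) \prod_k G k (w k)).
  by apply: eq_bigr => w _; apply: eq_bigr => k _; rewrite [dffun_of_fprod w k]ffunE.
(* The default [0] of [untag] is never reached: the choice functions summed over send [k] to an
   element tagged [k]. *)
rewrite (big_fprod_dep _ _ G predT) big_mkcondr /= -(bigA_distr_big_dep (tagged_with T) (fun i => untag 0 (G i))).
apply: eq_bigr => k _; rewrite -(big_tag (fun k => G k)) [RHS]big_mkcond.
by apply: eq_bigr => x _; rewrite ffunE.
Qed.

Section Bayes.

Variables (R : realFieldType) (n : nat) (E : rel 'I_n).
Variables (Theta : finType) (S : 'I_n -> finType).
Variables (nu : 'I_n -> Theta -> R) (l : forall k : 'I_n, Theta -> S k -> R).
Hypothesis nu_gt0 : forall k th, 0 < nu k th.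
Hypothesis l_gt0 : forall k th (x : S k), 0 < l th x.

Definition evidence (j : 'I_n) (x : S j) : R := \sum_th nu j th * l th x.

(** The argument [th] witnesses that [Theta] is inhabited, so that the sum is not empty. *)
Lemma evidence_gt0 (th : Theta) j (x : S j) : 0 < evidence x.
Proof.
rewrite /evidence (bigD1 th) //= ltr_wpDr ?mulr_gt0 //.
by apply: sumr_ge0 => th' _; rewrite mulr_ge0 ?ltW.
Qed.

Lemma likelihoodE j (x : S j) th :
  l th x = evidence x * (belief0 nu l x th / nu j th).
Proof.
have e0 := lt0r_neq0 (evidence_gt0 th x); have n0 := lt0r_neq0 (nu_gt0 j th).
rewrite ffunE -/(evidence x) [_ / evidence x]mulrC -mulrA mulVKf //.
by rewrite mulrAC divff ?mul1r.
Qed.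

(** The state-independent constant that cancels in the posterior: the total evidence of the signals
    that cannot be told from [y] by the belief they induce. *)
Definition belief_evidence j (y : S j) : R :=
  \sum_(x : S j | belief0 nu l x == belief0 nu l y) evidence x.

Lemma belief_evidence_gt0 (th : Theta) j (y : S j) : 0 < belief_evidence y.
Proof.
rewrite /belief_evidence (bigD1 y) //= ltr_wpDr ?evidence_gt0 //.
by apply: sumr_ge0 => x _; rewrite ltW ?evidence_gt0.
Qed.

Lemma belief_likelihoodE j (y : S j) th :
  \sum_(x : S j | belief0 nu l x == belief0 nu l y) l th x =
  belief_evidence y * (belief0 nu l y th / nu j th).
Proof.
rewrite mulr_suml; apply: eq_bigr => x /eqP xy.
by rewrite (likelihoodE x) xy.
Qed.

(** Recasts the information of agent [i] as one condition per agent, the shape required by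
    [sum_dffun_prod]; it is vacuous for agents that are neither [i] nor neighbors. *)
Definition consistent i (s : profile S) k : pred (S k) := fun x =>
  if k == i then x == s k
  else (k \in nbhd E i) ==> (belief0 nu l x == belief0 nu l (s k)).

Lemma info_eventE i s (w : Theta * profile S) : i \notin nbhd E i ->
  (w \in info_event nu l E i s) = [forall k, consistent i s (w.2 k)].
Proof.
move=> iN; rewrite inE /consistent; apply/andP/forallP => [[wi /forallP wN] k|wP].
  by case: (eqVneq k i) => [->|_].
split; first by have := wP i; rewrite eqxx.
apply/forallP => j; have := wP j.
by case: (eqVneq j i) => [->|_]; first rewrite (negPf iN).
Qed.

(** The sum over profiles factors by agent: [i] contributes the likelihood of its own signal, each
    neighbor the likelihood of its belief, and every other agent a total mass of 1. *)
Lemma prob_state_info i s th :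
    i \notin nbhd E i -> (forall k th, \sum_(x : S k) l th x = 1) ->
  prob (joint_law nu l i) ([set w | w.1 == th] :&: info_event nu l E i s) =
  (\prod_(j in nbhd E i) belief_evidence (s j)) *
  (nu i th * l th (s i) *
   \prod_(j in nbhd E i) (belief0 nu l (s j) th / nu j th)).
Proof.
move=> iN l1.
transitivity (\sum_(v : profile S | [forall k, consistent i s (v k)])
    nu i th * \prod_k l th (v k)).
  rewrite /prob /joint_law.
  rewrite (eq_bigl (fun w : Theta * profile S =>
    (w.1 == th) && [forall k, consistent i s (w.2 k)])); last first.
    by move=> w; rewrite inE info_eventE // inE.
  rewrite -(pair_big (pred1 th) (fun v : profile S =>
      [forall k, consistent i s (v k)])
    (fun th' v => nu i th' * \prod_k l th' (v k))) /=.
  by rewrite big_pred1_eq.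
rewrite -mulr_sumr (sum_dffun_prod (fun k => consistent i s (k:=k))
  (fun k => @l k th)) -mulrA mulrCA; congr (_ * _).
rewrite (bigD1 i) //= mulrCA; congr (_ * _).
  rewrite (big_pred1 (s i)) // => x.
  by rewrite /consistent eqxx.
(* The product over neighbors is extended by factors 1 to all agents other than [i], to be compared
   factor by factor. *)
rewrite -big_split /= [RHS]big_mkcond [RHS](bigD1 i) //= (negPf iN) mul1r.
apply: eq_bigr => k /negPf ki; rewrite /consistent ki.
by case: ifP => kN; rewrite /= ?belief_likelihoodE ?l1.
Qed.

End Bayes.

Theorem lemma2 (R : realFieldType) (n : nat) (E : rel 'I_n)
    (E_irr : forall i : 'I_n, i \notin nbhd E i)
    (Theta : finType) (S : 'I_n -> finType)
    (nu : 'I_n -> Theta -> R)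
    (l : forall k : 'I_n, Theta -> S k -> R)
    (nu_pmf : forall k : 'I_n, is_pmf (nu k))
    (nu_gt0 : forall (k : 'I_n) (th : Theta), 0 < nu k th)
    (l_pmf : forall (k : 'I_n) (th : Theta), is_pmf (l k th))
    (l_gt0 : forall (k : 'I_n) (th : Theta) (x : S k), 0 < l k th x)
    (i : 'I_n) (s : profile S) (th : Theta) :
  belief1 nu l E i s th =
    nu i th * l i th (s i) *
      (\prod_(j in nbhd E i) (belief0 nu l (s j) th / nu j th)) /
    \sum_(th' : Theta) nu i th' * l i th' (s i) *
      (\prod_(j in nbhd E i) (belief0 nu l (s j) th' / nu j th')).
Proof.
have l1 k th' : \sum_x l k th' x = 1 by case: (l_pmf k th').
have K0 : \prod_(j in nbhd E i) belief_evidence nu l (s j) != 0.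
  by apply/prodf_neq0 => j _; rewrite lt0r_neq0 ?(belief_evidence_gt0 nu_gt0 l_gt0 th).
(* Law of total probability over the state, which produces the sum in the denominator. *)
have total : prob (joint_law nu l i) (info_event nu l E i s) =
    \sum_th' prob (joint_law nu l i)
      ([set w | w.1 == th'] :&: info_event nu l E i s).
  rewrite /prob (partition_big fst predT) //=; apply: eq_bigr => th' _.
  by apply: eq_bigl => w; rewrite in_setI inE andbC [w \in [set _ | _]]inE.
have joint := prob_state_info nu_gt0 l_gt0 s _ (E_irr i) l1.
rewrite /belief1 /cond_prob total joint (eq_bigr _ (fun th' _ => joint th')).
by rewrite -mulr_sumr -mulf_div divff // mul1r.
Qed.
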